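(* Let $\Lambda=(\lambda_{i,j})$ be an optimal hyperplane cover of a $d$-dimensional extremal $(0,1)$-matrix of order $n$ with deficiency $\delta$. (1) If $\delta=1$, then all $\lambda_{i,j}\in\{0,1\}$. (2) There are no extremal matrices with deficiency $\delta$ satisfying $\tfrac12<\delta<1$. If $\delta=\tfrac12$, then all $\lambda_{i,j}\in\{0,\tfrac12,1\}$. (3) There are no extremal matrices with deficiency $\delta$ satisfying $\tfrac13<\delta<\tfrac12$. If $\delta=\tfrac13$, then all $\lambda_{i,j}\in\{0,\tfrac13,\tfrac23,1\}$.
   Context: A $d$-dimensional matrix of order $n$ is an array $(a_\alpha)_{\alpha\in\{1,\dots,n\}^d}$; $\mathrm{supp}(A)=\{\alpha:a_\alpha\ne0\}$; the hyperplane $\Gamma_{i,j}$ is the set of indices with $\alpha_i=j$. A polyplex of weight $W$ is a nonnegative matrix $K$ of order $n$ whose entries sum to at most $1$ over each hyperplane and to $W$ in total; a polydiagonal is a polyplex of weight $n$. A $(0,1)$-matrix $A$ contains $K$ if $\mathrm{supp}(K)\subseteq\mathrm{supp}(A)$. A hyperplane cover of $A$ is a nonnegative $d\times n$ table $\Lambda=(\lambda_{i,j})$ with $\sum_{i=1}^d\lambda_{i,\alpha_i}\ge1$ for all $\alpha\in\mathrm{supp}(A)$; its weight is the sum of its entries; it is optimal if it has minimum weight among hyperplane covers of $A$. A $(0,1)$-matrix $A$ is extremal if it contains no polydiagonal, but for every index $\alpha$ with $a_\alpha=0$ the matrix obtained by changing $a_\alpha$ to $1$ contains a polydiagonal. The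 deficiency of an extremal matrix of order $n$ is $n$ minus the maximum weight of a polyplex contained in it. *)

(* Defs.v *)
From HB Require Import structures.
From mathcomp Require Import all_boot all_order all_algebra.
From mathcomp Require Import reals.

Set Implicit Arguments.
Unset Strict Implicit.
Unset Printing Implicit Defensive.

Import Order.TTheory GRing.Theory Num.Theory.
Local Open Scope ring_scope.

Definition index (d n : nat) := {ffun 'I_d -> 'I_n}.

Definition dmatrix (R : realType) (d n : nat) := {ffun index d n -> R}.

Section Matrices.
Context {R : realType} {d n : nat}.
Implicit Types (A K : dmatrix R d n) (L : 'M[R]_(d, n)) (W delta : R).

Definition supp A : {set index d n} := [set a : index d n | A a != 0].

Definition hyperplane (i : 'I_d) (j : 'I_n) : {set index d n} :=
  [set a : index d n | a i == j].

Definition zero_one A : Prop := forall a, A a = 0 \/ A a = 1.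

Definition polyplex W K : Prop :=
  [/\ forall a, 0 <= K a,
      forall i j, \sum_(a in hyperplane i j) K a <= 1
    & \sum_a K a = W].

Definition polydiagonal K : Prop := polyplex n%:R K.

Definition contains A K : Prop := supp K \subset supp A.

Definition has_polydiagonal A : Prop :=
  exists2 K, polydiagonal K & contains A K.

Definition hyperplane_cover A L : Prop :=
  (forall i j, 0 <= L i j) /\
  (forall a, a \in supp A -> 1 <= \sum_i L i (a i)).

Definition cover_weight L : R := \sum_i \sum_j L i j.

Definition optimal_cover A L : Prop :=
  hyperplane_cover A L /\
  forall L', hyperplane_cover A L' -> cover_weight L <= cover_weight L'.

Definition set_one A (a : index d n) : dmatrix R d n :=
  [ffun b => if b == a then 1 else A b].

Definition extremal A : Prop :=
  [/\ zero_one A,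
      ~ has_polydiagonal A
    & forall a, A a = 0 -> has_polydiagonal (set_one A a)].

Definition max_polyplex_weight A W : Prop :=
  (exists2 K, polyplex W K & contains A K) /\
  forall W' K, polyplex W' K -> contains A K -> W' <= W.

(* A relation rather than a function, so that the maximum weight is a genuine
   maximum and no junk value is involved. *)
Definition has_deficiency A delta : Prop :=
  exists2 W, max_polyplex_weight A W & delta = n%:R - W.

End Matrices.

(* Main.v *)
(* By linear programming duality an optimal cover L has weight n - delta and
   satisfies complementary slackness with a maximum polyplex: every positive
   entry of L lies on a support index of cover sum exactly 1.  Pairing L with
   the polydiagonal created by an index outside the support shows that such an
   index has cover sum at most 1 - delta, so no cover sum lies in
   (1 - delta, 1).  Optimality also forces a zero in every row of L.  Hence the
   entries of L are 0, 1, or in [delta, 1 - delta].  If all entries are 0, 1 or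
   in (1/3, 2/3), rounding the last ones to 1/2 keeps every tight sum equal to
   1, hence keeps the weight, and 2 delta is an integer. *)
Require Import Defs.
From HB Require Import structures.
From mathcomp Require Import all_boot all_order all_algebra.
From mathcomp Require Import reals.
From mathcomp Require Import lra.

Set Implicit Arguments.
Unset Strict Implicit.
Unset Printing Implicit Defensive.

Import Order.TTheory GRing.Theory Num.Theory.
Local Open Scope ring_scope.

(** * Farkas' lemma over an ordered field *)

Section Farkas.
Variable R : realFieldType.

(* Induction on the generators.  If x separates b from the cone of the other
   generators but a i0 . x < 0, project everything along a i0 onto the
   hyperplane orthogonal to x and apply the induction hypothesis there. *)
Lemma farkas_cone (I : eqType) (J : finType) (r : seq I) (a : I -> J -> R)
    (b : J -> R) : uniq r ->
  (exists2 y : I -> R, forall i, 0 <= y i &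
     forall j, b j = \sum_(i <- r) y i * a i j) \/
  (exists2 x : J -> R, forall i, i \in r -> 0 <= \sum_j a i j * x j &
     \sum_j b j * x j < 0).
Proof.
elim: r a b => [|i0 r IHr] a b /=.
  move=> _; case: (altP (@forallP _ (fun j => b j == 0))) => [b0|].
    by left; exists (fun=> 0) => // j; rewrite big_nil; apply/eqP.
  rewrite negb_forall => /existsP[j bj]; right; exists (fun j => - b j) => //.
  rewrite (bigD1 j) //= ltr_wnDr //.
    by apply: sumr_le0 => k _; rewrite mulrN oppr_le0 -expr2 sqr_ge0.
  by rewrite mulrN oppr_lt0 -expr2 exprn_even_gt0.
case/andP=> i0r ur.
have extend (t : R) (y : I -> R) (c : I -> R) :
    \sum_(i <- r) (if i == i0 then t else y i) * c i = \sum_(i <- r) y i * c i.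
  apply: eq_big_seq => i ir; case: eqP => // ei.
  by rewrite -ei ir in i0r.
have [[y y0 yb]|[x xr xb]] := IHr a b ur.
  left; exists (fun i => if i == i0 then 0 else y i) => [i|j].
    by case: ifP.
  by rewrite big_cons eqxx mul0r add0r extend.
have [x0|x0] := lerP 0 (\sum_j a i0 j * x j).
  by right; exists x => // i; rewrite inE => /predU1P[->|/xr].
set q := \sum_j a i0 j * x j in x0.
(* Chosen so that [v + s v * a i0] is orthogonal to [x]. *)
pose s (v : J -> R) := (\sum_j v j * x j) / - q.
have [[y y0 yb]|[z zr zb]] :=
    IHr (fun i j => a i j + s (a i) * a i0 j) (fun j => b j + s b * a i0 j) ur.
  (* The coefficient of [a i0] collects the projection terms; it is nonnegative because
     [s b <= 0 <= s (a i)] for [i] in [r]. *)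
  left; exists (fun i => if i == i0 then \sum_(i <- r) y i * s (a i) - s b
                         else y i) => [i|j].
    case: ifP => // _; rewrite subr_ge0 (@le_trans _ _ 0) //.
      by rewrite /s ler_pdivrMr ?oppr_gt0 // mul0r ltW.
    rewrite big_seq sumr_ge0 // => k kr; rewrite mulr_ge0 // divr_ge0 ?xr //.
    by rewrite oppr_ge0 ltW.
  rewrite big_cons eqxx extend mulrBl mulr_suml.
  have := yb j; under eq_bigr do rewrite mulrDr mulrA.
  by rewrite big_split /= => /eqP; rewrite -subr_eq => /eqP <-; lra.
pose u := \sum_j a i0 j * z j.
(* The corrected vector is the image of [z] under the adjoint of the projection. *)
have dotE (v : J -> R) : \sum_j v j * (z j + u / - q * x j) =
    \sum_j (v j + s v * a i0 j) * z j.
  rewrite (eq_bigr (fun j => v j * z j + (u / - q) * (v j * x j))); last first.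
    by move=> j _; rewrite mulrDr mulrCA.
  rewrite [RHS](eq_bigr (fun j => v j * z j + s v * (a i0 j * z j))); last first.
    by move=> j _; rewrite mulrDl mulrA.
  rewrite !big_split -!mulr_sumr /= /s -/u; congr (_ + _).
  by rewrite mulrAC [u * _]mulrC mulrAC.
right; exists (fun j => z j + u / - q * x j) => [i|]; last by rewrite dotE.
rewrite inE dotE => /predU1P[->|/zr//].
(* [s (a i0) = -1], so [a i0] itself projects to zero. *)
rewrite big1 // => j _; rewrite /s -/q invrN mulrN divff ?ltr0_neq0 //.
by rewrite mulN1r subrr mul0r.
Qed.

(** Negated unit vectors are added as generators: their coefficients are the slack of the
    inequalities, and they force the separating vector to be nonpositive, so its opposite serves as
    [y]. *)
Lemma farkas_le (I J : finType) (M : I -> J -> R) (h : J -> R) :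
  (exists2 l : I -> R, forall i, 0 <= l i &
     forall j, h j <= \sum_i l i * M i j) \/
  (exists y : J -> R, [/\ forall j, 0 <= y j,
     forall i, \sum_j M i j * y j <= 0 & 0 < \sum_j h j * y j]).
Proof.
pose a (k : I + J) (j : J) : R :=
  match k with inl i => M i j | inr j' => - (j' == j)%:R end.
have [[l l0 lh]|[x xr xh]] := farkas_cone a h (index_enum_uniq (I + J)%type).
  left; exists (l \o inl) => [i|j]; first exact: l0.
  rewrite lh big_sumType /= gerDl sumr_le0 // => j' _.
  by rewrite mulrN oppr_le0 mulr_ge0.
right; exists (fun j => - x j); split.
- move=> j; have := xr (inr j) (mem_index_enum _).
  rewrite (bigD1 j) //= eqxx mulN1r big1 ?addr0 // => k kj.
  by rewrite eq_sym (negPf kj) oppr0 mul0r.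
- move=> i; have := xr (inl i) (mem_index_enum _).
  by under [X in _ -> X <= _]eq_bigr do rewrite mulrN; rewrite sumrN oppr_le0.
- by under eq_bigr do rewrite mulrN; rewrite sumrN oppr_gt0.
Qed.

End Farkas.

(** * Duality between covers and polyplexes, gaps in cover sums, and rounding *)

Section Covers.
Context {R : realType} {d n : nat}.
Implicit Types (A K : dmatrix R d n) (L : 'M[R]_(d, n)) (a b : Defs.index d n).

Definition cover_sum L a : R := \sum_i L i (a i).

Definition set_coord a (i : 'I_d) (j : 'I_n) : Defs.index d n :=
  [ffun k => if k == i then j else a k].

(** Double counting of the terms [K a * F i (a i)]; every comparison of polyplexes with covers goes
    through it. *)
Lemma sum_hyperplane (K : Defs.index d n -> R) (F : 'I_d -> 'I_n -> R) :
  \sum_a K a * \sum_i F i (a i) =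
  \sum_i \sum_j F i j * \sum_(a in hyperplane i j) K a.
Proof.
under eq_bigr do rewrite mulr_sumr.
rewrite exchange_big; apply: eq_bigr => i _ /=.
rewrite (partition_big (fun a : Defs.index d n => a i) xpredT) //=.
apply: eq_bigr => j _; rewrite mulr_sumr.
apply: eq_big => [a|a /eqP->]; first by rewrite inE.
by rewrite mulrC.
Qed.

Lemma notin_supp A K a : contains A K -> a \notin supp A -> K a = 0.
Proof.
move=> /subsetP sKA; apply: contraNeq => Ka.
by apply: sKA; rewrite inE.
Qed.

Lemma le_sum_cover W K A L : polyplex W K -> contains A K ->
  hyperplane_cover A L -> W <= \sum_a K a * cover_sum L a.
Proof.
move=> [K0 _ <-] sKA [_ cL]; apply: ler_sum => a _.
have [/cL La|aA] := boolP (a \in supp A); first by rewrite ler_peMr.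
by rewrite (notin_supp sKA aA) mul0r.
Qed.

Lemma sum_cover_le W K L : polyplex W K -> (forall i j, 0 <= L i j) ->
  \sum_a K a * cover_sum L a <= cover_weight L.
Proof.
move=> [_ K1 _] L0; rewrite sum_hyperplane.
by do 2!apply: ler_sum => ? _; rewrite ler_piMr.
Qed.

Lemma weak_duality W K A L : polyplex W K -> contains A K ->
  hyperplane_cover A L -> W <= cover_weight L.
Proof.
move=> pK sKA cL; apply: le_trans (le_sum_cover pK sKA cL) _.
by apply: sum_cover_le pK _; case: cL.
Qed.

(** Farkas is applied to the covering constraints with one more column for weight at most [W]. In
    the other alternative [y] has hyperplane sums at most [t] on the support but total above
    [W * t], so [(K0 + y) / (1 + t)] is a polyplex heavier than [W]. Mixing in [K0] also handles
    [t = 0]. *)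
Lemma strong_duality A W : max_polyplex_weight A W ->
  exists2 L, hyperplane_cover A L & cover_weight L <= W.
Proof.
move=> [[K0 pK0 sK0] maxW].
pose M (p : 'I_d * 'I_n) (c : Defs.index d n + 'I_1) : R :=
  if c is inl a then ((a \in supp A) && (a p.1 == p.2))%:R else -1.
pose h (c : Defs.index d n + 'I_1) : R :=
  if c is inl a then (a \in supp A)%:R else - W.
have [[l l0 lh]|[y [y0 yM yh]]] := farkas_le M h.
  exists (\matrix_(i, j) l (i, j)).
    split=> [i j|a aA]; first by rewrite mxE.
    have := lh (inl a); rewrite /h aA => /le_trans; apply.
    have -> : \sum_p l p * M p (inl a) = \sum_i \sum_j l (i, j) * M (i, j) (inl a).
      by rewrite pair_bigA; apply: eq_bigr => -[].
    apply: ler_sum => i _; rewrite mxE (bigD1 (a i)) //= aA eqxx mulr1.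
    rewrite big1 ?addr0 // => j ja.
    by rewrite eq_sym (negPf ja) mulr0.
  have := lh (inr ord0); rewrite /h /= -mulr_suml mulrN1 lerN2 => /(le_trans _).
  apply; rewrite /cover_weight pair_bigA /=.
  by apply: ler_sum => -[i j] _; rewrite mxE.
have [K0_ge0 K0_1 K0W] := pK0; set t := y (inr ord0).
have t1 : 0 < 1 + t by rewrite ltr_pwDl //; exact: y0.
pose K : dmatrix R d n :=
  [ffun a => (K0 a + (a \in supp A)%:R * y (inl a)) / (1 + t)].
have pK : polyplex (\sum_a K a) K.
  split=> // [a|i j].
    by rewrite ffunE divr_ge0 ?(ltW t1) // addr_ge0 // mulr_ge0.
  under eq_bigr do rewrite ffunE.
  rewrite -mulr_suml ler_pdivrMr // mul1r big_split /= lerD //.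
  have := yM (i, j); rewrite big_sumType /= big_ord1 mulN1r subr_le0.
  apply: le_trans; rewrite [leLHS]big_mkcond /=; apply: ler_sum => a _.
  by rewrite inE; case: (a i == j); rewrite ?andbT ?andbF ?mul0r.
have sK : contains A K.
  apply/subsetP => a; rewrite inE; apply: contraNT => aA.
  by rewrite ffunE (negPf aA) (notin_supp sK0 aA) mul0r addr0 mul0r.
have := maxW _ _ pK sK; under eq_bigr do rewrite ffunE.
rewrite -mulr_suml ler_pdivrMr // big_split /= K0W mulrDr mulr1 lerD2l.
by move: yh; rewrite big_sumType /= big_ord1 mulNr subr_gt0 ltNge -/t => /negPf ->.
Qed.

(** Equal weights turn both inequalities of weak duality into equalities; each is a sum of
    nonnegative differences, which therefore all vanish. *)
Lemma complementary_slackness A K L :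
  polyplex (cover_weight L) K -> contains A K -> hyperplane_cover A L ->
  (forall a, K a * cover_sum L a = K a) /\
  (forall i j, L i j * \sum_(a in hyperplane i j) K a = L i j).
Proof.
move=> pK sKA cL; have [K0 K1 KW] := pK; have [L0 _] := cL.
have le1 := le_sum_cover pK sKA cL.
have le2 := sum_cover_le pK L0.
have eqW : \sum_a K a * cover_sum L a = cover_weight L.
  by apply/le_anti; rewrite le1 le2.
split.
  have /psumr_eq0P z : \sum_a (K a * cover_sum L a - K a) = 0.
    by rewrite sumrB eqW KW subrr.
  move=> a; apply/eqP; rewrite -subr_eq0; apply/eqP; apply: z => // b _.
  have [/(proj2 cL) Lb|bA] := boolP (b \in supp A).
    by rewrite subr_ge0 ler_peMr.
  by rewrite (notin_supp sKA bA) mul0r subrr.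
have := eqW; rewrite sum_hyperplane /cover_weight !pair_bigA /= => eqW'.
have /psumr_eq0P z : \sum_(p : 'I_d * 'I_n)
    (L p.1 p.2 - L p.1 p.2 * \sum_(a in hyperplane p.1 p.2) K a) = 0.
  by rewrite sumrB eqW' subrr.
move=> i j; apply/esym/eqP; rewrite -subr_eq0; apply/eqP.
by apply: (z _ (i, j)) => // p _; rewrite subr_ge0 ler_piMr.
Qed.

Lemma optimal_cover_weight A W L : max_polyplex_weight A W ->
  optimal_cover A L -> cover_weight L = W.
Proof.
move=> mW [cL optL]; have [[K pK sK] _] := mW.
have [L' cL' wL'] := strong_duality mW.
by apply/le_anti; rewrite (le_trans (optL _ cL') wL') (weak_duality pK sK cL).
Qed.

Lemma optimal_cover_exists A W : max_polyplex_weight A W ->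
  exists L, optimal_cover A L.
Proof.
move=> mW; have [[K pK sK] _] := mW.
have [L cL wL] := strong_duality mW; exists L; split=> // L' cL'.
exact: le_trans wL (weak_duality pK sK cL').
Qed.

(* If the row minima of L sum to m > 0, subtracting them and dividing by 1 - m
   gives a cover of weight n - (n - w) / (1 - m), which is smaller than w. *)
Lemma optimal_cover_zero A L : optimal_cover A L -> cover_weight L < n%:R ->
  exists a, forall i, L i (a i) = 0.
Proof.
move=> [[L0 cL] optL] ltw.
have n0 : (0 < n)%N.
  by rewrite -(ltr_nat R); apply: le_lt_trans ltw; do 2!apply: sumr_ge0 => ? _.
pose j0 := Ordinal n0.
pose a : Defs.index d n := [ffun i => [arg min_(j < j0) L i j]%O].
have mina i j : L i (a i) <= L i j.
  by rewrite ffunE; case: arg_minP => // k _; apply.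
set m := cover_sum L a.
have m0 : 0 <= m by apply: sumr_ge0.
have nm (F : 'I_d -> R) : \sum_(i < d) \sum_(j < n) F i = n%:R * \sum_i F i.
  by rewrite mulr_sumr; apply: eq_bigr => i _; rewrite sumr_const card_ord mulr_natl.
have m1 : m < 1.
  have n0' : 0 < n%:R :> R by rewrite ltr0n.
  rewrite -(ltr_pM2l n0') mulr1; apply: le_lt_trans ltw.
  by rewrite -nm; do 2!apply: ler_sum => ? _.
have m1' : 0 < 1 - m by rewrite subr_gt0.
pose L' : 'M[R]_(d, n) := \matrix_(i, j) ((L i j - L i (a i)) / (1 - m)).
have cL' : hyperplane_cover A L'.
  split=> [i j|b bA]; first by rewrite mxE divr_ge0 ?subr_ge0 // ltW.
  under eq_bigr do rewrite mxE.
  rewrite -mulr_suml sumrB ler_pdivlMr // mul1r lerB //; exact: cL.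
have wL' : cover_weight L' = (cover_weight L - n%:R * m) / (1 - m).
  rewrite -nm -sumrB mulr_suml; apply: eq_bigr => i _.
  by rewrite -sumrB mulr_suml; apply: eq_bigr => j _; rewrite mxE.
(* With [w] the weight of [L], minimality rearranges to [m * (n - w) <= 0]. *)
have := optL _ cL'; rewrite wL' ler_pdivlMr // => le1.
have m_eq0 : m = 0.
  apply/le_anti; rewrite m0 andbT -(pmulr_rle0 _ (_ : 0 < n%:R - cover_weight L)).
    by nra.
  by rewrite subr_gt0.
exists a => i; apply: (psumr_eq0P _ m_eq0) => //.
Qed.

(** By slackness [K] has sum 1 over the hyperplane of a positive entry, hence a nonzero entry there,
    and slackness makes that index tight. *)
Lemma tight_index A K L i j :
  polyplex (cover_weight L) K -> contains A K -> hyperplane_cover A L ->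
  0 < L i j -> exists2 a : Defs.index d n, a i = j & cover_sum L a = 1.
Proof.
move=> pK sKA cL Lij; have [csK csL] := complementary_slackness pK sKA cL.
have H1 : \sum_(a in hyperplane i j) K a != 0.
  by apply/eqP => H0; have := csL i j; rewrite H0 mulr0 => H; rewrite -H ltxx in Lij.
have [a aH Ka] : exists2 a, a \in hyperplane i j & K a != 0.
  apply/exists_inP; apply: contraNT H1; rewrite negb_exists_in => /forall_inP H.
  by rewrite big1 // => a /H; rewrite negbK => /eqP.
exists a; first by move: aH; rewrite inE => /eqP.
by apply: (mulfI Ka); rewrite csK mulr1.
Qed.

Lemma cover_sum_set_coord L a i j :
  cover_sum L (set_coord a i j) = cover_sum L a - L i (a i) + L i j.
Proof.
rewrite /cover_sum (bigD1 i) //= [in RHS](bigD1 i) //= ffunE eqxx addrC.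
rewrite [L i (a i) + _]addrC addrK; congr (_ + _); apply: eq_bigr => k ki.
by rewrite ffunE (negPf ki).
Qed.

(* The argument i excludes d = 0, where no hyperplane bounds K a by 1. *)
Lemma extremal_gap A L (i : 'I_d) a : extremal A -> hyperplane_cover A L ->
  cover_weight L < n%:R ->
  cover_sum L a <= 1 - (n%:R - cover_weight L) \/ 1 <= cover_sum L a.
Proof.
move=> [zoA _ exA] cL ltw.
have [/(proj2 cL)|] := boolP (a \in supp A); first by right.
rewrite inE negbK => /eqP aA; left.
have [K pK sK] := exA a aA; have [K0 K1 KW] := pK.
have := sum_cover_le pK (proj1 cL).
(* Only [a] may lie in the support of [K] but outside that of [A]; all other indices of that support
   have cover sum at least 1. *)
have : \sum_b K b - K a + K a * cover_sum L a <= \sum_b K b * cover_sum L b.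
  rewrite [X in X - _](bigD1 a) //= [K a + _]addrC addrK.
  rewrite [leRHS](bigD1 a) //= [leRHS]addrC lerD2r.
  apply: ler_sum => b ba.
  have [/(proj2 cL) Lb|] := boolP (b \in supp A); first by rewrite ler_peMr.
  rewrite inE negbK => bA; rewrite (notin_supp sK) ?mul0r //.
  by rewrite inE ffunE (negPf ba) negbK.
rewrite KW => le1 le2.
have Ka1 : K a <= 1.
  apply: le_trans (K1 i (a i)); rewrite (bigD1 a) ?inE //= lerDl.
  by apply: sumr_ge0.
have gapK := le_trans le1 le2; have := K0 a.
set c := cover_sum L a in gapK *; set w := cover_weight L in ltw gapK *.
move: (K a) Ka1 gapK => k k1 gapK k0.
(* Here [n - w <= k * (1 - c)]. If [c <= 1], the right side is at most [1 - c]; if [c > 1], it is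
   nonpositive, against [w < n]. *)
have [c1|c1] := lerP c 1.
  have : 0 <= (1 - k) * (1 - c) by rewrite mulr_ge0 ?subr_ge0.
  lra.
have : 0 <= k * (c - 1) by rewrite mulr_ge0 // subr_ge0 ltW.
lra.
Qed.

(* Twice the rounded value, so that it is an integer. *)
Definition round_half (x : R) : nat :=
  if x == 0 then 0 else if x == 1 then 2 else 1.

Lemma round_half_middle (x : R) : 1 / 3 < x < 2 / 3 -> round_half x = 1%N.
Proof.
move=> /andP[lo hi]; rewrite /round_half.
by rewrite gt_eqF ?lt_eqF //; lra.
Qed.

Lemma half_integral_weight A K L :
  polyplex (cover_weight L) K -> contains A K -> hyperplane_cover A L ->
  (forall i j, [\/ L i j = 0, L i j = 1 | 1 / 3 < L i j < 2 / 3]) ->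
  exists N : nat, N%:R = 2 * cover_weight L.
Proof.
move=> pK sKA cL vL; have [csK csL] := complementary_slackness pK sKA cL.
have [K0 K1 KW] := pK; have [L0 _] := cL.
(* The factors 3/2 and 3 confine the doubled rounded sum of a tight index to the interval from 3/2
   to 3, the upper end excluded, where 2 is the only integer. *)
have ge_r i j : 3 / 2 * L i j <= (round_half (L i j))%:R.
  case: (vL i j) => [->|->|h]; last by rewrite round_half_middle //; lra.
  - by rewrite /round_half eqxx mulr0.
  - by rewrite /round_half oner_eq0 eqxx; lra.
have lt_r i j : 0 < L i j -> (round_half (L i j))%:R < 3 * L i j.
  case: (vL i j) => [->|->|h]; last by rewrite round_half_middle //; lra.
  - by rewrite ltxx.
  - by rewrite /round_half oner_eq0 eqxx; lra.
have le_r i j : (round_half (L i j))%:R <= 3 * L i j.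
  have := L0 i j; rewrite le_eqVlt => /predU1P[<-|/lt_r/ltW//].
  by rewrite /round_half eqxx mulr0.
have tight_r a : cover_sum L a = 1 -> (\sum_i round_half (L i (a i)) = 2)%N.
  move=> La; have [i Li] : exists i, 0 < L i (a i).
    apply/existsP; apply: contraT; rewrite negb_exists => /forallP H.
    have : cover_sum L a = 0.
      apply: big1 => i _; apply/le_anti; rewrite L0 andbT leNgt; exact: H.
    by rewrite La => /eqP; rewrite oner_eq0.
  have lt3 : (\sum_i round_half (L i (a i)) < 3)%N.
    rewrite -(ltr_nat R) natr_sum.
    have -> : 3%:R = \sum_i 3 * L i (a i) :> R by rewrite -mulr_sumr [\sum_i _]La mulr1.
    rewrite (bigD1 i) //= [ltRHS](bigD1 i) //= ltr_leD ?lt_r //.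
    by apply: ler_sum.
  have gt1 : (1 < \sum_i round_half (L i (a i)))%N.
    rewrite -(ltr_nat R) natr_sum.
    apply: lt_le_trans (_ : \sum_i 3 / 2 * L i (a i) <= _); last exact: ler_sum.
    by rewrite -mulr_sumr [\sum_i _]La; lra.
  by apply/eqP; rewrite eqn_leq -ltnS lt3 gt1.
exists (\sum_i \sum_j round_half (L i j))%N.
rewrite natr_sum; under eq_bigr do rewrite natr_sum.
(* Both slackness conditions are used: tight indices give [2 * K a] each, and hyperplanes of nonzero
   entries have [K]-sum 1. *)
transitivity (\sum_a K a * \sum_i (round_half (L i (a i)))%:R); last first.
  rewrite mulrC -KW mulr_suml; apply: eq_bigr => a _.
  have [->|Ka] := eqVneq (K a) 0; first by rewrite !mul0r.
  by rewrite -natr_sum tight_r //; apply: (mulfI Ka); rewrite csK mulr1.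
rewrite (sum_hyperplane K (fun i j => (round_half (L i j))%:R)).
apply: eq_bigr => i _; apply: eq_bigr => j _.
have [Lij|Lij] := eqVneq (L i j) 0; first by rewrite /round_half Lij eqxx mul0r.
by rewrite (_ : \sum_(a in _) _ = 1) ?mulr1 //; apply: (mulfI Lij); rewrite csL mulr1.
Qed.

End Covers.

(** * Possible entries of an optimal cover *)

Section Values.
Context {R : realType} {d n : nat} (A K : dmatrix R d n) (L : 'M[R]_(d, n)).
Context (delta : R).
Hypotheses (exA : extremal A) (oL : optimal_cover A L).
Hypotheses (pK : polyplex (cover_weight L) K) (sKA : contains A K).
Hypotheses (wL : cover_weight L = n%:R - delta) (delta0 : 0 < delta).

Let cL : hyperplane_cover A L := proj1 oL.
Let L0 : forall i j, 0 <= L i j := proj1 cL.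

Let ltw : cover_weight L < n%:R.
Proof. by rewrite wL gtrBl. Qed.

Let gap (i : 'I_d) a : cover_sum L a <= 1 - delta \/ 1 <= cover_sum L a.
Proof. by have := extremal_gap i a exA cL ltw; rewrite wL subKr. Qed.

Lemma entry_le1 i j : L i j <= 1.
Proof.
have := L0 i j; rewrite le_eqVlt => /predU1P[<-//|Lij].
have [a <- <-] := tight_index pK sKA cL Lij.
by rewrite /cover_sum (bigD1 i) //= lerDl sumr_ge0.
Qed.

(** Moving coordinate [i] of a tight index to a zero of row [i] lowers its cover sum to [1 - L i j],
    which is below 1 and so falls under the gap. *)
Lemma entry_ge i j : 0 < L i j -> delta <= L i j.
Proof.
move=> Lij; have [a ai La] := tight_index pK sKA cL Lij.
have [z z0] := optimal_cover_zero oL ltw.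
have := gap i (set_coord a i (z i)).
by rewrite cover_sum_set_coord La ai z0; case; lra.
Qed.

(** An index through zeros in all rows but [i] has cover sum [L i j], to which the gap applies. *)
Lemma entry_le i j : L i j <= 1 - delta \/ L i j = 1.
Proof.
have [z z0] := optimal_cover_zero oL ltw.
have := gap i (set_coord z i j); rewrite cover_sum_set_coord z0 subr0.
rewrite /cover_sum big1 // add0r => -[|L1]; first by left.
by right; apply/le_anti; rewrite entry_le1.
Qed.

Lemma entry_pair i j k l : k != i ->
  L i j + L k l <= 1 - delta \/ 1 <= L i j + L k l.
Proof.
move=> ki; have [z z0] := optimal_cover_zero oL ltw.
have := gap i (set_coord (set_coord z i j) k l).
rewrite !cover_sum_set_coord ffunE (negPf ki) !z0 !subr0.
by rewrite /cover_sum big1 // add0r.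
Qed.

Lemma entry_partner i j : 0 < L i j -> L i j < 1 ->
  exists k l, [/\ k != i, 0 < L k l & L i j + L k l <= 1].
Proof.
move=> Lij Lij1; have [a ai La] := tight_index pK sKA cL Lij.
have [k ki Lk] : exists2 k, k != i & 0 < L k (a k).
  apply/exists_inP; apply: contraT; rewrite negb_exists_in => /forall_inP H.
  move: La; rewrite /cover_sum (bigD1 i) //= ai big1 ?addr0 => [E|k ki].
    by rewrite E ltxx in Lij1.
  by apply/le_anti; rewrite L0 andbT leNgt H.
exists k, (a k); split=> //.
rewrite -La /cover_sum (bigD1 i) //= ai (bigD1 k) //= lerD2l lerDl.
exact: sumr_ge0.
Qed.

Lemma entry_cases i j : [\/ L i j = 0, L i j = 1 | delta <= L i j <= 1 - delta].
Proof.
have := L0 i j; rewrite le_eqVlt => /predU1P[<-|/entry_ge ge]; first exact: Or31.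
by case: (entry_le i j) => le; [apply: Or33; rewrite ge|apply: Or32].
Qed.

Lemma deficiency_half_integral :
  (forall i j, [\/ L i j = 0, L i j = 1 | 1 / 3 < L i j < 2 / 3]) ->
  ~ (1 / 2 < delta < 1) /\ ~ (0 < delta < 1 / 2).
Proof.
move=> /(half_integral_weight pK sKA cL)[N]; rewrite wL mulrBr -natrM => wN.
(* In both ranges [2 * delta], the integer [2 * n - N], would lie strictly between consecutive
   integers. *)
split=> /andP[lo hi].
  have N1 : (N + 1 < 2 * n)%N by rewrite -(ltr_nat R) natrD; lra.
  have : (2 * n < N + 2)%N by rewrite -(ltr_nat R) natrD; lra.
  by rewrite addn2 ltnS leqNgt -addn1 N1.
have N1 : (N < 2 * n)%N by rewrite -(ltr_nat R); lra.
have : (2 * n < N + 1)%N by rewrite -(ltr_nat R) natrD; lra.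
by rewrite addn1 ltnS leqNgt N1.
Qed.

(* A value x strictly between 1/3 and 2/3 has such a partner y in another row,
   and 1/3 cannot share an index with x or with y; so 1/3 does not occur, and
   neither does 2/3, whose partner would be 1/3. *)
Lemma entry_third i j : delta = 1 / 3 -> 1 / 3 < L i j < 2 / 3 -> False.
Proof.
move=> dE /andP[xlo xhi].
have [||k [l [ki y0 xy]]] := @entry_partner i j; [lra|lra|].
have := entry_ge y0; rewrite dE => ylo.
(* The two entries sum to more than 2/3, so to at least 1 by the gap, while the first is below
   2/3. *)
have yE : 1 / 3 < L k l by have := entry_pair j l ki; rewrite dE; case; lra.
(* Both [L i j] and [L k l] lie strictly between 1/3 and 2/3. Adding 1/3 from a different row to
   either gives a sum inside the forbidden gap from 2/3 to 1. *)
have no13 p q : L p q != 1 / 3.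
  apply/eqP => Lpq; have [pi|pi] := eqVneq p i.
    have := @entry_pair p q k l; rewrite pi ki -pi Lpq dE => /(_ isT) []; lra.
  by have := entry_pair j q pi; rewrite Lpq dE => -[]; lra.
have [_] : ~ (1 / 2 < delta < 1) /\ ~ (0 < delta < 1 / 2).
  apply: deficiency_half_integral => p q.
  case: (entry_cases p q); [exact: Or31|exact: Or32|rewrite dE => /andP[lo hi]].
  apply: Or33; rewrite lt_neqAle eq_sym no13 lo /=.
  rewrite lt_neqAle (_ : L p q <= 2 / 3) ?andbT; last by lra.
  apply/eqP => Lpq; have [||r [s [_ rs0 rs1]]] := @entry_partner p q; [lra|lra|].
  have := entry_ge rs0; have /eqP := no13 r s; rewrite dE => ne ge.
  by apply: ne; lra.
by apply; rewrite dE; lra.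
Qed.

End Values.

Theorem theorem5p8 (R : realType) (d n : nat) (A : dmatrix R d n) (delta : R)
    (hA : extremal A) (hdelta : has_deficiency A delta) :
  [/\ delta = 1 ->
        forall L : 'M[R]_(d, n), optimal_cover A L ->
          forall i j, L i j \in [:: 0; 1],
      ~ (1 / 2 < delta < 1) /\
      (delta = 1 / 2 ->
        forall L : 'M[R]_(d, n), optimal_cover A L ->
          forall i j, L i j \in [:: 0; 1 / 2; 1])
    & ~ (1 / 3 < delta < 1 / 2) /\
      (delta = 1 / 3 ->
        forall L : 'M[R]_(d, n), optimal_cover A L ->
          forall i j, L i j \in [:: 0; 1 / 3; 2 / 3; 1])].
Proof.
have [W mW dW] := hdelta; have [[K pK sK] _] := mW.
have wL L : optimal_cover A L -> cover_weight L = n%:R - delta.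
  by move=> /(optimal_cover_weight mW) ->; rewrite dW subKr.
have pL L : optimal_cover A L -> polyplex (cover_weight L) K.
  by move=> /(optimal_cover_weight mW) ->.
have cases L i j (oL : optimal_cover A L) (delta0 : 0 < delta) :=
  entry_cases hA oL (pL L oL) sK (wL L oL) delta0 i j.
(* For such [delta] the range from [delta] to [1 - delta] lies strictly between 1/3 and 2/3. The
   nonexistence claims supply no cover, so an optimal one is obtained from duality. *)
have half : 1 / 3 < delta -> ~ (1 / 2 < delta < 1) /\ ~ (0 < delta < 1 / 2).
  move=> d3; have delta0 : 0 < delta by lra.
  have [L oL] := optimal_cover_exists mW.
  apply: (deficiency_half_integral oL (pL L oL) sK (wL L oL)) => i j.
  by case: (cases L i j oL delta0) => [||/andP[lo hi]];
    [exact: Or31|exact: Or32|apply: Or33; lra].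
split; [|split|split].
(* The middle range is empty for [delta = 1]; below, it is a single point for [delta = 1 / 2]. *)
- move=> d1 L oL i j; have delta0 : 0 < delta by lra.
  by rewrite !inE; case: (cases L i j oL delta0) => [->|->|]; rewrite ?eqxx ?orbT //; lra.
- by move=> h; case: half => [|/(_ h)//]; lra.
- move=> d1 L oL i j; have delta0 : 0 < delta by lra.
  rewrite !inE; case: (cases L i j oL delta0) => [->|->|/andP[lo hi]];
    rewrite ?eqxx ?orbT //.
  by rewrite (_ : L i j = 1 / 2) ?eqxx ?orbT //; lra.
- by move=> h; case: half => [|_ []]; lra.
- move=> d1 L oL i j; have delta0 : 0 < delta by lra.
  rewrite !inE; case: (cases L i j oL delta0) => [->|->|/andP[lo hi]];
    rewrite ?eqxx ?orbT //.
  (* Only the endpoints of the middle range survive, since [entry_third] excludes its interior. *)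
  have [|ne1] := eqVneq (L i j) (1 / 3); first by rewrite orbT.
  have [|ne2] := eqVneq (L i j) (2 / 3); first by rewrite !orbT.
  case: (entry_third hA oL (pL L oL) sK (wL L oL) delta0 (i := i) (j := j) d1).
  rewrite lt_neqAle eq_sym ne1 lt_neqAle ne2 /=.
  by apply/andP; split; lra.
Qed.
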